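(* For a positive integer $n$, let $f_{n,i}$ be the coefficient of $x^i$ in $(1+x+x^2)^n$, and consider the linear program: minimize $3\sum_{i=0}^{2n} f_{n,i}t_i$ over real $(t_0,\dots,t_{2n})$ subject to $t_i\ge 0$ for all $i$ and $t_i+t_j+t_k\ge 1$ for all $i,j,k\in\{0,\dots,2n\}$ (not necessarily distinct) with $i+j+k\le 2n$. Then for all sufficiently large $n$, an optimal solution is given by: (1) if $n=3s$: $t_i=1$ for $0\le i\le 2s-2$, $t_{2s-1}=\frac23$, $t_{2s}=\frac13$, and $t_i=0$ for $i\ge 2s+1$; (2) if $n=3s-1$: $t_i=1$ for $0\le i\le 2s-4$, $t_{2s-3}=\frac45$, $t_{2s-2}=\frac35$, $t_{2s-1}=\frac25$, $t_{2s}=\frac15$, and $t_i=0$ for $i\ge 2s+1$; (3) if $n=3s-2$: $t_i=1$ for $0\le i\le 2s-4$, $t_{2s-3}=\frac34$, $t_{2s-2}=\frac12$, $t_{2s-1}=\frac14$, and $t_i=0$ for $i\ge 2s$. *)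

(* Defs.v *)
From HB Require Import structures.
From mathcomp Require Import all_boot all_order all_algebra.
From mathcomp Require Import reals.

Set Implicit Arguments.
Unset Strict Implicit.
Unset Printing Implicit Defensive.

Import Order.TTheory GRing.Theory Num.Theory.

Local Open Scope ring_scope.

Section LinearProgram.
Variable R : realType.

Definition trinomial_coef (n i : nat) : R :=
  ((1 + 'X + 'X^2) ^+ n : {poly R})`_i.

Definition objective (n : nat) (t : 'I_(2 * n).+1 -> R) : R :=
  3 * \sum_(i < (2 * n).+1) trinomial_coef n i * t i.

Definition feasible (n : nat) (t : 'I_(2 * n).+1 -> R) : Prop :=
  (forall i, 0 <= t i) /\
  (forall i j k : 'I_(2 * n).+1, (i + j + k <= 2 * n)%N ->
     1 <= t i + t j + t k).

Definition optimal (n : nat) (t : 'I_(2 * n).+1 -> R) : Prop :=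
  feasible t /\
  (forall u : 'I_(2 * n).+1 -> R, feasible u -> objective t <= objective u).

(* In the three candidate solutions below, conditions such as [i <= 2s - 2] and
   [i = 2s - 1] are written [i + 2 <= 2s] and [i + 1 = 2s], to keep clear of
   the truncated subtraction of [nat]. *)

(* n = 3s *)
Definition sol0 (s i : nat) : R :=
  if (i + 2 <= 2 * s)%N then 1
  else if (i + 1 == 2 * s)%N then 2 / 3
  else if (i == 2 * s)%N then 1 / 3
  else 0.

(* n = 3s - 1 *)
Definition sol1 (s i : nat) : R :=
  if (i + 4 <= 2 * s)%N then 1
  else if (i + 3 == 2 * s)%N then 4 / 5
  else if (i + 2 == 2 * s)%N then 3 / 5
  else if (i + 1 == 2 * s)%N then 2 / 5
  else if (i == 2 * s)%N then 1 / 5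
  else 0.

(* n = 3s - 2 *)
Definition sol2 (s i : nat) : R :=
  if (i + 4 <= 2 * s)%N then 1
  else if (i + 3 == 2 * s)%N then 3 / 4
  else if (i + 2 == 2 * s)%N then 1 / 2
  else if (i + 1 == 2 * s)%N then 1 / 4
  else 0.

End LinearProgram.

(* Main.v *)
Require Import Defs.
From mathcomp Require Import all_boot all_order all_algebra.
From mathcomp Require Import reals ring lra zify.

(* Write n = 3m + L + 1 with L = 2, 4, 3 and b = 2m + L + 1.  In all three cases
   the candidate is 1 up to 2m, then decreases linearly to 0, reached at b.
   Optimality is weak duality: every index 2m - d is matched with
   b + floor(d/2) and b + ceil(d/2), and a few triples among 2m+1, ..., b
   absorb the intermediate coefficients exactly.  The dual weights are
   feasible as soon as consecutive trinomial coefficients near 2n/3 have ratio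
   between 13/8 and 9/5 (the limit is (1 + sqrt 33)/4 = 1.686...).  These bounds
   follow from log-concavity combined with the three-term recurrence of the
   coefficients. *)

Import Order.TTheory GRing.Theory Num.Theory.

Local Open Scope ring_scope.

(** * Log-concavity of trinomial coefficients and bounds on consecutive ratios *)

Section LogConcavity.
Variable R : realType.
Implicit Types (a : nat -> R) (n i j : nat).

(** Quantifying over all pairs [i <= j], not just neighbours, excludes internal zeros of nonnegative
    sequences and avoids any division in the inductions. *)
Definition log_concave a : Prop :=
  forall i j, (i <= j)%N -> a i * a j.+1 <= a i.+1 * a j.

(** Put D(x,y) = a(x+1)a(y) - a(x)a(y+1). The claim is that the nine D(i+p,j+q) with p, q <= 2 have
    nonnegative sum. Each is nonnegative by hypothesis, except D(i+2,j) when j = i+1; antisymmetry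
    of D then cancels it against D(i+1,j+1). *)
Lemma log_concave_window3 a : log_concave a ->
  log_concave (fun i => a i + a i.+1 + a i.+2).
Proof.
move=> lca i j; rewrite leq_eqVlt => /orP[/eqP-> | lt_ij].
  by rewrite mulrC.
have h0 := lca i j (ltnW lt_ij).
have h1 := lca i j.+1 (leqW (ltnW lt_ij)).
have h2 := lca i.+1 j lt_ij.
have h3 := lca i j.+2 (leqW (leqW (ltnW lt_ij))).
have h4 := lca i.+1 j.+1 (leqW lt_ij).
have h5 := lca i.+2 j.+2 (leqW lt_ij).
have h6 := lca i.+1 j.+2 (leqW (leqW lt_ij)).
have h7 := lca i.+2 j.+1 lt_ij.
have [e|ne] := eqVneq j i.+1.
  by move: h0 h1 h2 h3 h4 h5 h6 h7; rewrite e; lra.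
have h8 := lca i.+2 j ltac:(lia).
lra.
Qed.

Lemma log_concave_coefXM (p : {poly R}) : (forall i, 0 <= p`_i) ->
  log_concave (fun i => p`_i) -> log_concave (fun i => ('X * p)`_i).
Proof.
move=> p0 lcp [|i] [|j] //; rewrite !coefXM /=.
- by rewrite mul0r mulr0.
- by rewrite mul0r mulr_ge0.
- by rewrite ltnS; exact: lcp.
Qed.

Lemma coefXM_ge0 (p : {poly R}) : (forall i, 0 <= p`_i) ->
  forall i, 0 <= ('X * p)`_i.
Proof. by move=> p0 [|i]; rewrite coefXM /=. Qed.

(** Shifting by ['X] twice turns the backward window [i-2, i-1, i] into a forward one, with zeros
    supplied at the boundary. *)
Lemma coef_trinomM (p : {poly R}) i :
  ((1 + 'X + 'X^2) * p)`_i =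
  ('X * ('X * p))`_i + ('X * ('X * p))`_i.+1 + ('X * ('X * p))`_i.+2.
Proof.
rewrite !mulrDl mul1r !coefD expr2 -mulrA !coefXM /=.
by rewrite -addrA addrC [X in X + _]addrC.
Qed.

Lemma trinomial_coef_ge0 n i : 0 <= trinomial_coef R n i.
Proof.
rewrite /trinomial_coef; elim: n i => [|n IHn] i.
  by rewrite expr0 coef1 ler0n.
by rewrite exprS coef_trinomM !addr_ge0 //; do 2!apply: coefXM_ge0.
Qed.

Lemma log_concave_trinomial_coef n : log_concave (trinomial_coef R n).
Proof.
have ge0 k := trinomial_coef_ge0 k.
rewrite /trinomial_coef; elim: n => [|n IHn].
  move=> i j; rewrite expr0 !coef1 /= mulr0 => _.
  by rewrite mulr_ge0 ?ler0n.
move=> i j le_ij; rewrite exprS !coef_trinomM.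
have ge0' := ge0 n; rewrite /trinomial_coef in ge0'.
apply: (log_concave_window3 (fun i => ('X * ('X * _))`_i) _ i j le_ij).
apply: log_concave_coefXM; first exact: coefXM_ge0.
exact: log_concave_coefXM.
Qed.

(** For p = 1 + X + X^2 and q = p^n, compare the coefficients of X^(i+1) in p q' = n q (1 + 2X). *)
Lemma trinomial_coef_rec n i :
  i.+2%:R * trinomial_coef R n i.+2 =
    (n%:R - i.+1%:R) * trinomial_coef R n i.+1
    + (2 * n%:R - i%:R) * trinomial_coef R n i.
Proof.
rewrite /trinomial_coef; set p : {poly R} := 1 + 'X + 'X^2; set q := p ^+ n.
have dq : p * q^`() = (q * (1 + 'X *+ 2)) *+ n.
  rewrite /q deriv_exp /p !derivD derivX derivC derivXn /= add0r expr1.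
  case: n @q => [|n] q; first by rewrite !mulr0n mulr0.
  by rewrite /= mulrnAr mulrCA -exprS mulrC.
have E : q`_i.+2 *+ i.+2 + q`_i.+1 *+ i.+1 + q`_i *+ i
    = (q`_i.+1 + q`_i *+ 2) *+ n.
  have: (p * q^`())`_i.+1 = ((q * (1 + 'X *+ 2)) *+ n)`_i.+1 by rewrite dq.
  rewrite coefMn mulrDr mulr1 coefD [q * _]mulrnAr coefMn coefMX /= => <-.
  rewrite /p !mulrDl mul1r !coefD expr2 -mulrA !coefXM /= !coef_deriv.
  by case: i => [|i]; rewrite ?coef_deriv ?mulr0n.
lra.
Qed.

(* Since [f i.+1 * f i.-1 <= f i ^+ 2], replacing [f i.+1] in the three-term
   recurrence leaves a quadratic inequality for the ratio [f i / f i.-1]. *)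
Lemma trinomial_ratio_ge n i p q : (i.+1 <= n)%N ->
  (p ^ 2 * i.+2 <= p * q * (n - i.+1) + q ^ 2 * (2 * n - i))%N ->
  p%:R * trinomial_coef R n i <= q%:R * trinomial_coef R n i.+1.
Proof.
move=> le_in hpq; have := trinomial_coef_rec n i.
have := log_concave_trinomial_coef n i i.+1 (leqnSn i).
have := trinomial_coef_ge0 n i; have := trinomial_coef_ge0 n i.+1.
have: (0 : R) < 2 * n%:R - i%:R.
  by rewrite subr_gt0 -natrM ltr_nat; lia.
have: (0 : R) <= n%:R - i.+1%:R by rewrite subr_ge0 ler_nat.
have: p%:R ^+ 2 * i.+2%:R <=
    p%:R * q%:R * (n%:R - i.+1%:R) + q%:R ^+ 2 * (2 * n%:R - i%:R) :> R.
  rewrite -natrB // -[2 * n%:R]natrM -natrB; last lia.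
  by rewrite -!natrX -!natrM -natrD ler_nat.
have: (0 : R) <= p%:R by [].
have: (0 : R) <= q%:R by [].
have: (0 : R) < i.+2%:R by rewrite ltr0n.
move: (trinomial_coef R n i) (trinomial_coef R n i.+1)
  (trinomial_coef R n i.+2) p%:R q%:R i.+2%:R (n%:R - i.+1%:R)
  (2 * n%:R - i%:R) => x y z P Q A B C A0 Q0 P0 hABC B0 C0 y0 x0 xz rec.
rewrite leNgt; apply/negP => lt_yx.
have Py0 : 0 <= P * y by rewrite mulr_ge0.
(* If Q y < P x, the facts below chain to A P^2 x z = P^2 x (B y + C x) > y^2 (P Q B + Q^2 C) >= A
   P^2 y^2 >= A P^2 x z. Strictness comes from [e2]. *)
have e1 : 0 <= B * (P * y) * (P * x - Q * y).
  by rewrite !mulr_ge0 // subr_ge0 ltW.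
have e2 : 0 < C * ((P * x - Q * y) * (P * x + Q * y)).
  rewrite mulr_gt0 // mulr_gt0 ?subr_gt0 //.
  by have := mulr_ge0 Q0 y0; lra.
have e3 : 0 <= A * P ^+ 2 * (y * y - x * z).
  by rewrite !mulr_ge0 ?exprn_ge0 ?subr_ge0 // ltW.
have e4 : 0 <= y * y * (P * Q * B + Q ^+ 2 * C - P ^+ 2 * A).
  by rewrite !mulr_ge0 ?subr_ge0.
have e5 : A * P ^+ 2 * (x * z) = P ^+ 2 * x * (B * y + C * x).
  by rewrite -rec; ring.
lra.
Qed.

(** Dual argument: the recurrence is multiplied by [f i.+2], and log-concavity bounds [f i * f i.+2]
    by the square of [f i.+1], leaving a quadratic inequality for [f i.+2 / f i.+1]. *)
Lemma trinomial_ratio_le n i p q : (i.+1 <= n)%N ->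
  (p * q * (n - i.+1) + q ^ 2 * (2 * n - i) <= p ^ 2 * i.+2)%N ->
  q%:R * trinomial_coef R n i.+2 <= p%:R * trinomial_coef R n i.+1.
Proof.
move=> le_in hpq; have := trinomial_coef_rec n i.
have := log_concave_trinomial_coef n i i.+1 (leqnSn i).
have := trinomial_coef_ge0 n i.+2; have := trinomial_coef_ge0 n i.+1.
have: (0 : R) < 2 * n%:R - i%:R.
  by rewrite subr_gt0 -natrM ltr_nat; lia.
have: (0 : R) <= n%:R - i.+1%:R by rewrite subr_ge0 ler_nat.
have: p%:R * q%:R * (n%:R - i.+1%:R) + q%:R ^+ 2 * (2 * n%:R - i%:R)
    <= p%:R ^+ 2 * i.+2%:R :> R.
  rewrite -natrB // -[2 * n%:R]natrM -natrB; last lia.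
  by rewrite -!natrX -!natrM -natrD ler_nat.
have: (0 : R) <= p%:R by [].
have: (0 : R) <= q%:R by [].
move: (trinomial_coef R n i) (trinomial_coef R n i.+1)
  (trinomial_coef R n i.+2) p%:R q%:R i.+2%:R (n%:R - i.+1%:R)
  (2 * n%:R - i%:R) => x y z P Q A B C Q0 P0 hABC B0 C0 y0 z0 xz rec.
rewrite leNgt; apply/negP => lt_yz.
have Py0 : 0 <= P * y by rewrite mulr_ge0.
have e1 : 0 <= B * (P * z) * (Q * z - P * y).
  by rewrite !mulr_ge0 // subr_ge0 ltW.
have e2 : 0 < C * ((Q * z - P * y) * (Q * z + P * y)).
  by rewrite mulr_gt0 // mulr_gt0 ?subr_gt0 //; lra.
have e3 : 0 <= C * P ^+ 2 * (y * y - x * z).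
  by rewrite !mulr_ge0 ?exprn_ge0 ?subr_ge0 // ltW.
have e4 : 0 <= z * z * (P ^+ 2 * A - (P * Q * B + Q ^+ 2 * C)).
  by rewrite !mulr_ge0 ?subr_ge0.
have e5 : P ^+ 2 * z * (A * z) = P ^+ 2 * z * (B * y + C * x) by rewrite rec.
lra.
Qed.

Lemma trinomial_coef_homo n i j : (i <= j)%N -> (j <= n)%N ->
  trinomial_coef R n i <= trinomial_coef R n j.
Proof.
elim: j => [|j IHj]; first by rewrite leqn0 => /eqP->.
rewrite leq_eqVlt => /orP[/eqP-> // | lt_ij] le_jn.
apply: le_trans (IHj lt_ij (ltnW le_jn)) _.
(* For [p = q = 1] the numerical condition reduces to j + 1 <= n. *)
by have := @trinomial_ratio_ge n j 1 1 le_jn; rewrite !mul1r; apply; lia.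
Qed.

End LogConcavity.

(** * Weak duality and the common shape of the candidates *)

Section WeakDuality.
Variable R : realType.
Implicit Types (n m N : nat) (U : nat -> R).

(** Regroups by [V e], which occurs once for d = 2e - 1, twice for d = 2e and once for d = 2e + 1.
    The extra term [h M.*2.+1 * V M] completes the last group, so that the induction closes. *)
Lemma sum_halves_le (h G V : nat -> R) M :
    (forall e, 0 <= V e) ->
    2 * h 0%N + h 1%N <= G 0%N ->
    (forall e, (e < M)%N ->
       h e.*2.+1 + 2 * h e.*2.+2 + h e.*2.+3 <= G e.+1) ->
  \sum_(d < M.*2.+1) h d * (V d./2 + V (uphalf d)) + h M.*2.+1 * V M
    <= \sum_(e < M.+1) G e * V e.
Proof.
move=> V0 G0; elim: M => [|M IHM] GS.
  rewrite !big_ord_recr !big_ord0 /=.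
  by have := mulr_ge0 (V0 0%N) (_ : 0 <= G 0%N - (2 * h 0%N + h 1%N));
    rewrite subr_ge0 => /(_ G0); lra.
rewrite doubleS 2!big_ord_recr [leRHS]big_ord_recr /=.
rewrite uphalf_double doubleK.
have := IHM (fun e lt_eM => GS e (leqW lt_eM)).
have := mulr_ge0 (V0 M.+1)
  (_ : 0 <= G M.+1 - (h M.*2.+1 + 2 * h M.*2.+2 + h M.*2.+3)).
by rewrite subr_ge0 => /(_ (GS M (leqnn _))); lra.
Qed.

Definition lp_feasible n U : Prop :=
  (forall i, 0 <= U i) /\
  (forall i j k, (i + j + k <= 2 * n)%N -> 1 <= U i + U j + U k).

(* Dual solution: the weight [f (2m - d)] goes to the constraint
   [(2m - d, b + floor(d/2), b + ceil(d/2))] with [b = 2m + L + 1]; the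
   constraints among the indices [2m + 1, ..., b] may use up [kappa] at [b]. *)
Lemma dual_bound n m L kappa U :
    n = (m.*2.+1 + L + m)%N -> lp_feasible n U ->
    let f := trinomial_coef R n in
    kappa + 2 * f m.*2 + f m.*2.-1 <= f (m.*2.+1 + L)%N ->
    4 * f m.*2.-1 <= f (m.*2.+1 + L)%N ->
  \sum_(i < m.*2.+1) f i
    + (\sum_(j < L) f (m.*2.+1 + j)%N * U (m.*2.+1 + j)%N
       + kappa * U (m.*2.+1 + L)%N)
  <= \sum_(i < (2 * n).+1) f i * U i.
Proof.
move=> def_n [U0 Uc] f hk h4.
have f0 i : 0 <= f i := trinomial_coef_ge0 R n i.
set b := (m.*2.+1 + L)%N.
have -> : (2 * n).+1 = (m.*2.+1 + L + m.+1 + n)%N by lia.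
rewrite 3!big_split_ord /= -/b.
have tail0 : 0 <= \sum_(i < n) f (b + m.+1 + i)%N * U (b + m.+1 + i)%N.
  by apply: sumr_ge0 => i _; rewrite mulr_ge0.
pose h d := f (m.*2 - d)%N; pose V e := U (b + e)%N.
pose G e := f (b + e)%N - (if e is 0%N then kappa else 0).
have halves : \sum_(d < m.*2.+1) h d * (V d./2 + V (uphalf d))
    + h m.*2.+1 * V m <= \sum_(e < m.+1) G e * V e.
  apply: sum_halves_le => [e||e lt_em]; first exact: U0.
    by rewrite /h /G subn0 subn1 addn0; lra.
  (* The weights 1 + 2 + 1 explain the factor 4 in [h4]; monotonicity applies because
     [b + e.+1 <= b + m = n]. *)
  rewrite /G subr0; apply: le_trans (_ : f b <= _); last first.
    by apply: trinomial_coef_homo; lia.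
  have le_h d : (0 < d)%N -> h d <= f m.*2.-1.
    by move=> d0; apply: trinomial_coef_homo; lia.
  have := le_h e.*2.+1 isT; have := le_h e.*2.+2 isT.
  by have := le_h e.*2.+3 isT; lra.
have sumG : \sum_(e < m.+1) G e * V e
    = \sum_(e < m.+1) f (b + e)%N * U (b + e)%N - kappa * U b.
  rewrite !big_ord_recl /= /V addn0 /G.
  under eq_bigr do rewrite /= subr0.
  by rewrite addn0; lra.
have revf : \sum_(i < m.*2.+1) f i = \sum_(d < m.*2.+1) h d.
  by rewrite (reindex_inj rev_ord_inj); apply: eq_bigr => d _; rewrite /= subSS.
have revU : \sum_(i < m.*2.+1) f i * U i
    = \sum_(d < m.*2.+1) h d * U (m.*2 - d)%N.
  by rewrite (reindex_inj rev_ord_inj); apply: eq_bigr => d _; rewrite /= subSS.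
(* The three indices add up to exactly 2m + 2b = 2n. *)
have triples : \sum_(d < m.*2.+1) h d <=
    \sum_(d < m.*2.+1) h d * U (m.*2 - d)%N
    + \sum_(d < m.*2.+1) h d * (V d./2 + V (uphalf d)).
  rewrite -big_split; apply: ler_sum => d _ /=.
  rewrite -mulrDr ler_peMr ?f0 // /V addrA; apply: Uc.
  by have := ltn_ord d; lia.
(* The leftover term of [halves], where truncated subtraction makes [h m.*2.+1] equal to [f 0]; it
   is nonnegative and dropped. *)
have := mulr_ge0 (f0 (m.*2 - m.*2.+1)%N) (U0 (b + m)%N).
rewrite revf revU; move: halves; rewrite sumG /V /h; lra.
Qed.

Definition stair m L i : R :=
  if (i <= m.*2)%N then 1
  else if (i < m.*2.+1 + L)%N then (m.*2.+1 + L - i)%:R / L.+1%:R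
  else 0.

Lemma eq_stair m L (t : nat -> R) :
    (forall i, (i <= m.*2)%N -> t i = 1) ->
    (forall j, (j < L)%N -> t (m.*2.+1 + j)%N = (L - j)%:R / L.+1%:R) ->
    (forall i, (m.*2.+1 + L <= i)%N -> t i = 0) ->
  t =1 stair m L.
Proof.
move=> t1 tmid t0 i; rewrite /stair; case: (leqP i m.*2) => [le_i | lt_i]; first exact: t1.
case: ltnP => [lt_ib | le_bi]; last exact: t0.
by rewrite -{1}(subnKC lt_i) tmid; [congr (_%:R / _) | ]; lia.
Qed.

(** An index up to 2m already contributes 1. Otherwise, with b = 2m + 1 + L, the bound b - x <= (L +
    1) [stair m L x] summed over the triple gives at least 3b - 2n = b - 2m = L + 1. *)
Lemma stair_feasible n m L :
  n = (m.*2.+1 + L + m)%N -> lp_feasible n (stair m L).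
Proof.
move=> def_n; have st0 i : 0 <= stair m L i.
  by rewrite /stair; case: ifP => // _; case: ifP => // _; rewrite divr_ge0.
split=> // i j k le_ijk.
have L0 : (0 : R) < L.+1%:R by rewrite ltr0n.
have low x : (x <= m.*2)%N -> stair m L x = 1 by rewrite /stair => ->.
have high x : (m.*2 < x)%N ->
    (m.*2.+1 + L)%:R - x%:R <= L.+1%:R * stair m L x.
  move=> lt_x; rewrite /stair leqNgt lt_x /=; case: ltnP => [lt_xb | le_bx].
    by rewrite mulrCA divff ?gt_eqF // mulr1 natrB // ltnW.
  by rewrite mulr0 subr_le0 ler_nat.
have := st0 i; have := st0 j; have := st0 k.
case: (leqP i m.*2) => [/low-> | /high hi]; first lra.
case: (leqP j m.*2) => [/low-> | /high hj]; first lra.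
case: (leqP k m.*2) => [/low-> | /high hk]; first lra.
move=> _ _ _; rewrite -(ler_pM2l L0) mulr1 !mulrDr.
have : i%:R + j%:R + k%:R + L.+1%:R <= 3 * (m.*2.+1 + L)%:R :> R.
  by rewrite -!natrD -natrM ler_nat; lia.
lra.
Qed.

(** Reduces optimality to two growth conditions and an inequality on the [L] intermediate indices,
    where [kappa] is the share of the coefficient at 2m + 1 + L lent to that inequality. *)
Lemma stair_optimal n m L kappa (t : 'I_(2 * n).+1 -> R) :
    n = (m.*2.+1 + L + m)%N -> (forall i, t i = stair m L i) ->
    let f := trinomial_coef R n in
    kappa + 2 * f m.*2 + f m.*2.-1 <= f (m.*2.+1 + L)%N ->
    4 * f m.*2.-1 <= f (m.*2.+1 + L)%N ->
    (forall U, lp_feasible n U ->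
      \sum_(j < L) f (m.*2.+1 + j)%N * ((L - j)%:R / L.+1%:R) <=
      \sum_(j < L) f (m.*2.+1 + j)%N * U (m.*2.+1 + j)%N
        + kappa * U (m.*2.+1 + L)%N) ->
  optimal t.
Proof.
move=> def_n tE f hk h4 core; split.
  have [st0 stc] := stair_feasible _ _ _ def_n.
  by split=> [i | i j k le_ijk]; rewrite !tE //; apply: stc.
move=> u [u0 uc]; rewrite /objective ler_pM2l ?ltr0n //.
(* Indices beyond 2n are sent to 0, which is harmless: a sum at most 2n keeps every index in
   range. *)
pose U i := u (inord i).
have feasU : lp_feasible n U.
  split=> [i | i j k le_ijk]; first exact: u0.
  by apply: uc; rewrite !inordK //; lia.
have -> : \sum_(i < (2 * n).+1) trinomial_coef R n i * u i
    = \sum_(i < (2 * n).+1) f i * U i.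
  by apply: eq_bigr => i _; rewrite /U inord_val.
apply: le_trans (dual_bound _ _ _ _ _ def_n feasU hk h4).
apply: le_trans (_ : \sum_(i < m.*2.+1) f i
  + \sum_(j < L) f (m.*2.+1 + j)%N * ((L - j)%:R / L.+1%:R) <= _); last first.
  by rewrite lerD2l; apply: core.
under eq_bigr do rewrite tE.
have -> : (2 * n).+1 = (m.*2.+1 + L + (m.+1 + n))%N by lia.
rewrite 2!big_split_ord /= -/f [X in _ + X]big1 ?addr0 => [|i _]; last first.
  by rewrite /stair ifN ?ifN ?mulr0 //; lia.
rewrite lerD //; apply: ler_sum => i _.
  by rewrite /stair -ltnS ltn_ord mulr1.
rewrite /stair ifN; last lia.
by rewrite ltn_add2l ltn_ord subnDl.
Qed.

End WeakDuality.

(** * Numerical growth bounds and explicit dual weights for the three residues *)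

Section Cases.
Variable R : realType.
Implicit Types n m : nat.

Section Growth.
Variables n m : nat.
Hypotheses (m_ge : (50 <= m)%N) (n_ge : (3 * m + 3 <= n)%N)
  (n_le : (n <= 3 * m + 5)%N).
Local Notation f := (trinomial_coef R n).

(** For a geometric sequence of ratio r, the tightest use, in [sol0_optimal], asks r^4 >= r^2 + 2r +
    1, so r must reach the golden ratio; 13/8 lies just above it. *)
Lemma growth_ge i : (i < 2 * m + 5)%N -> 13 * f i <= 8 * f i.+1.
(* The worst case i = 2m + 4, n = 3m + 3 amounts to 22m >= 1094, whence [m_ge]. *)
Proof. by move=> hi; apply: (@trinomial_ratio_ge R n i 13 8); lia. Qed.

Lemma growth_le i : (2 * m <= i)%N -> (i < n)%N -> 5 * f i.+1 <= 9 * f i.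
Proof.
case: i => [|i] hi lt_in; first lia.
by apply: (@trinomial_ratio_le R n i 9 5); lia.
Qed.

End Growth.

Lemma sol0_stair m : sol0 R m.+1 =1 stair R m 2.
Proof.
rewrite /sol0; apply: eq_stair => [i hi | [|[|j]] // _ | i hi].
- by rewrite ifT //; lia.
- rewrite ifN; last lia; rewrite ifT; last lia.
  by [].
- do 2![rewrite ifN; last lia]; rewrite ifT; last lia.
  by [].
- by do 3![rewrite ifN; last lia].
Qed.

Lemma sol1_stair m : sol1 R m.+2 =1 stair R m 4.
Proof.
rewrite /sol1; apply: eq_stair => [i hi | [|[|[|[|j]]]] // _ | i hi].
- by rewrite ifT //; lia.
- rewrite ifN; last lia; rewrite ifT; last lia.
  by [].
- do 2![rewrite ifN; last lia]; rewrite ifT; last lia.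
  by [].
- do 3![rewrite ifN; last lia]; rewrite ifT; last lia.
  by [].
- do 4![rewrite ifN; last lia]; rewrite ifT; last lia.
  by [].
- by do 5![rewrite ifN; last lia].
Qed.

Lemma sol2_stair m : sol2 R m.+2 =1 stair R m 3.
Proof.
rewrite /sol2; apply: eq_stair => [i hi | [|[|[|j]]] // _ | i hi].
- by rewrite ifT //; lia.
- rewrite ifN; last lia; rewrite ifT; last lia.
  by [].
- do 2![rewrite ifN; last lia]; rewrite ifT; last lia.
  by rewrite subSS subn0; lra.
- do 3![rewrite ifN; last lia]; rewrite ifT; last lia.
  by [].
- by do 4![rewrite ifN; last lia].
Qed.

Lemma sol0_optimal n m : (50 <= m)%N -> n = (3 * m + 3)%N ->
  optimal (fun i : 'I_(2 * n).+1 => sol0 R m.+1 i).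
Proof.
move=> m50 def_n; pose f := trinomial_coef R n.
have ge i := growth_ge n m m50 ltac:(lia) ltac:(lia) i.
have := ge m.*2.-1 ltac:(lia); rewrite prednK; last lia; move=> gN.
have g0 := ge m.*2 ltac:(lia).
have g1 := ge m.*2.+1 ltac:(lia).
have g2 := ge m.*2.+2 ltac:(lia).
have fN : 0 <= f m.*2.-1 := trinomial_coef_ge0 R n _.
rewrite -/f in gN g0 g1 g2.
apply: (@stair_optimal R n m 2 (f m.*2.+1)); rewrite -/f ?addn2 ?addn1.
- by clear -def_n; lia.
- by move=> i; apply: sol0_stair.
- lra.
- lra.
move=> U [U0 Uc].
rewrite !big_ord_recr !big_ord0 /= addn0 addn1 !add0r !subSS !subn0.
(* Offsets from 2m: [y1] weighs the triple (1,2,3) and [y2] weighs (2,2,2). The values solve y1 = f1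
   and y1 + 3 y2 = f2; offset 3 receives [kappa] = y1. *)
pose y1 := f m.*2.+1; pose y2 := (f m.*2.+2 - f m.*2.+1) / 3.
have y1_ge0 : 0 <= y1 by rewrite /y1; lra.
have y2_ge0 : 0 <= y2 by rewrite /y2; lra.
have s1 : 0 <= y1 * (U m.*2.+1 + U m.*2.+2 + U m.*2.+3 - 1).
  by rewrite mulr_ge0 // subr_ge0; apply: Uc; clear -def_n; lia.
have s2 : 0 <= y2 * (U m.*2.+2 + U m.*2.+2 + U m.*2.+2 - 1).
  by rewrite mulr_ge0 // subr_ge0; apply: Uc; clear -def_n; lia.
by rewrite /y1 /y2 in s1 s2; lra.
Qed.

Lemma sol1_optimal n m : (50 <= m)%N -> n = (3 * m + 5)%N ->
  optimal (fun i : 'I_(2 * n).+1 => sol1 R m.+2 i).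
Proof.
move=> m50 def_n; pose f := trinomial_coef R n.
have ge i := growth_ge n m m50 ltac:(lia) ltac:(lia) i.
have le i := growth_le n m m50 ltac:(lia) ltac:(lia) i.
have := ge m.*2.-1 ltac:(lia); rewrite prednK; last lia; move=> gN.
have g0 := ge m.*2 ltac:(lia).
have g1 := ge m.*2.+1 ltac:(lia).
have g2 := ge m.*2.+2 ltac:(lia).
have g3 := ge m.*2.+3 ltac:(lia).
have g4 := ge m.*2.+4 ltac:(lia).
have l1 := le m.*2.+1 ltac:(lia) ltac:(lia).
have l2 := le m.*2.+2 ltac:(lia) ltac:(lia).
have l3 := le m.*2.+3 ltac:(lia) ltac:(lia).
have fN : 0 <= f m.*2.-1 := trinomial_coef_ge0 R n _.
rewrite -/f in gN g0 g1 g2 g3 g4 l1 l2 l3.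
(* Weights of the triples (1,4,5), (2,4,4), (2,3,5), (3,3,4) of offsets from 2m. They solve y1 = f1,
   y2 + y3 = f2, y3 + 2 y4 = f3, y1 + 2 y2 + y4 = f4. The upper growth bounds serve to make [y3]
   nonnegative. *)
pose y1 := f m.*2.+1.
pose y2 := (2 * f m.*2.+4 - 2 * f m.*2.+1 - f m.*2.+3 + f m.*2.+2) / 5.
pose y3 := f m.*2.+2 - y2; pose y4 := (f m.*2.+3 - f m.*2.+2 + y2) / 2.
have y1_ge0 : 0 <= y1 by rewrite /y1; lra.
have y2_ge0 : 0 <= y2 by rewrite /y2; lra.
have y3_ge0 : 0 <= y3 by rewrite /y3 /y2; lra.
have y4_ge0 : 0 <= y4 by rewrite /y4 /y2; lra.
apply: (@stair_optimal R n m 4 (y1 + y3)); rewrite -/f ?addn4.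
- by clear -def_n; lia.
- by move=> i; apply: sol1_stair.
- by rewrite /y3 /y1; lra.
- lra.
move=> U [U0 Uc].
rewrite !big_ord_recr !big_ord0 /= addn0 addn1 addn2 addn3 !add0r !subSS !subn0.
have s1 : 0 <= y1 * (U m.*2.+1 + U m.*2.+4 + U m.*2.+1.+4 - 1).
  by rewrite mulr_ge0 // subr_ge0; apply: Uc; clear -def_n; lia.
have s2 : 0 <= y2 * (U m.*2.+2 + U m.*2.+4 + U m.*2.+4 - 1).
  by rewrite mulr_ge0 // subr_ge0; apply: Uc; clear -def_n; lia.
have s3 : 0 <= y3 * (U m.*2.+2 + U m.*2.+3 + U m.*2.+1.+4 - 1).
  by rewrite mulr_ge0 // subr_ge0; apply: Uc; clear -def_n; lia.
have s4 : 0 <= y4 * (U m.*2.+3 + U m.*2.+3 + U m.*2.+4 - 1).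
  by rewrite mulr_ge0 // subr_ge0; apply: Uc; clear -def_n; lia.
by rewrite /y4 /y3 /y2 /y1 in s1 s2 s3 s4 *; lra.
Qed.

Lemma sol2_optimal n m : (50 <= m)%N -> n = (3 * m + 4)%N ->
  optimal (fun i : 'I_(2 * n).+1 => sol2 R m.+2 i).
Proof.
move=> m50 def_n; pose f := trinomial_coef R n.
have ge i := growth_ge n m m50 ltac:(lia) ltac:(lia) i.
have le i := growth_le n m m50 ltac:(lia) ltac:(lia) i.
have := ge m.*2.-1 ltac:(lia); rewrite prednK; last lia; move=> gN.
have g0 := ge m.*2 ltac:(lia).
have g1 := ge m.*2.+1 ltac:(lia).
have g2 := ge m.*2.+2 ltac:(lia).
have g3 := ge m.*2.+3 ltac:(lia).
have l1 := le m.*2.+1 ltac:(lia) ltac:(lia).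
have l2 := le m.*2.+2 ltac:(lia) ltac:(lia).
have fN : 0 <= f m.*2.-1 := trinomial_coef_ge0 R n _.
rewrite -/f in gN g0 g1 g2 g3 l1 l2.
(* Weights of the triples (1,3,4), (2,3,3), (2,2,4) of offsets from 2m, solving y1 = f1, y2 + 2 y3 =
   f2, y1 + 2 y2 = f3. *)
pose y1 := f m.*2.+1; pose y2 := (f m.*2.+3 - f m.*2.+1) / 2.
pose y3 := (f m.*2.+2 - y2) / 2.
have y1_ge0 : 0 <= y1 by rewrite /y1; lra.
have y2_ge0 : 0 <= y2 by rewrite /y2; lra.
have y3_ge0 : 0 <= y3 by rewrite /y3 /y2; lra.
apply: (@stair_optimal R n m 3 (y1 + y3)); rewrite -/f ?addn3.
- by clear -def_n; lia.
- by move=> i; apply: sol2_stair.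
- by rewrite /y3 /y2 /y1; lra.
- lra.
move=> U [U0 Uc].
rewrite !big_ord_recr !big_ord0 /= addn0 addn1 addn2 !add0r !subSS !subn0.
have s1 : 0 <= y1 * (U m.*2.+1 + U m.*2.+3 + U m.*2.+4 - 1).
  by rewrite mulr_ge0 // subr_ge0; apply: Uc; clear -def_n; lia.
have s2 : 0 <= y2 * (U m.*2.+2 + U m.*2.+3 + U m.*2.+3 - 1).
  by rewrite mulr_ge0 // subr_ge0; apply: Uc; clear -def_n; lia.
have s3 : 0 <= y3 * (U m.*2.+2 + U m.*2.+2 + U m.*2.+4 - 1).
  by rewrite mulr_ge0 // subr_ge0; apply: Uc; clear -def_n; lia.
by rewrite /y3 /y2 /y1 in s1 s2 s3 *; lra.
Qed.

End Cases.

Theorem theorem2p4 (R : realType) :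
  exists N : nat, forall n : nat, (0 < n)%N -> (N <= n)%N -> forall s : nat,
    [/\ n = (3 * s)%N ->
          optimal (fun i : 'I_(2 * n).+1 => sol0 R s i),
        (n + 1 = 3 * s)%N ->
          optimal (fun i : 'I_(2 * n).+1 => sol1 R s i)
      & (n + 2 = 3 * s)%N ->
          optimal (fun i : 'I_(2 * n).+1 => sol2 R s i)].
Proof.
(* 155 = 3 * 50 + 5 forces [50 <= m] for each of n = 3m + 3, 3m + 5, 3m + 4. *)
exists 155%N => n _ n_ge s; split=> def_n.
- by case: s def_n => [|m] def_n; [lia | apply: sol0_optimal; lia].
- by case: s def_n => [|[|m]] def_n; [lia | lia | apply: sol1_optimal; lia].
- by case: s def_n => [|[|m]] def_n; [lia | lia | apply: sol2_optimal; lia].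
Qed.
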